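(* Let $n\ge1$. For every Hessenberg function $\mathbf m\colon[n]\to[n]$ and every integer $0\le k<n$, the coefficient of $e_k$ in the expansion of $g_k(G_{\mathbf m};x,1)$ (that is, $g_k(\mathbf m;x,q)$ evaluated at $q=1$) in the basis $(e_\lambda)$ of elementary symmetric functions is non-negative.
   Context: $[n]=\{1,\dots,n\}$. A Hessenberg function is a non-decreasing $\mathbf m\colon[n]\to[n]$ with $\mathbf m(i)\ge i$ for all $i$. $G_{\mathbf m}$ is the graph with vertex set $[n]$ and edges $\{i,j\}$ for $i<j\le\mathbf m(i)$, and $g_k(G_{\mathbf m};x,q):=g_k(\mathbf m;x,q)$. $h_j,e_j$ are the complete homogeneous and elementary symmetric functions ($h_0=e_0=1$), $e_\lambda=\prod_i e_{\lambda_i}$, and $\omega$ is the $q$-linear involution with $\omega(h_j)=e_j$. With $[n]_q=1+q+\dots+q^{n-1}$, $\rho_n$ ($n\ge1$) is defined recursively by $[n]_qh_n=\sum_{i=0}^{n-1}h_i\rho_{n-i}$ (at $q=1$, $\rho_n$ is the power sum $p_n$). $S_{n,\mathbf m}=\{\sigma\in S_n:\sigma(i)\le\mathbf m(i)\text{ for all }i\}$. Each $\sigma\in S_n$ is written as its cycle decomposition $\sigma=\tau_1\cdots\tau_j$ (fixed points included), each cycle beginning with its smallest element and cycles ordered increasingly by their smallest elements; $|\tau_i|$ is the length of $\tau_i$. $\sigma^c$ is the permutation whose one-line notation is obtained by erasing the parentheses (e.g. $\sigma=(154)(2639)(78)$ gives $\sigma^c=154263978$). $\mathrm{wt}_{\mathbf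 m}(\sigma)$ is the number of pairs $(i,j)$ with $i<j\le\mathbf m(i)$ and $(\sigma^c)^{-1}(i)>(\sigma^c)^{-1}(j)$. For $k<n$, \[ g_k(\mathbf m;x,q):=\sum_{\substack{\sigma=\tau_1\cdots \tau_{j}\in S_{n,\mathbf m}\\ |\tau_1|\geq n-k}} (-1)^{|\tau_1|-n+k}q^{\mathrm{wt}_{\mathbf m}(\sigma)}h_{|\tau_1|-n+k}\,\omega(\rho_{|\tau_2|}\cdots \rho_{|\tau_j|}). \] *)

(* Defs.v *)
From mathcomp Require Import all_boot all_order fingroup perm all_algebra.
From mathcomp.multinomials Require Import mpoly.

Set Implicit Arguments.
Unset Strict Implicit.
Unset Printing Implicit Defensive.

Import GRing.Theory.
Local Open Scope ring_scope.

(* The set [n] is 'I_n, shifted to start at 0: all conditions below only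
   compare elements of [n], so they are unaffected by the shift. *)

Section Hessenberg.
Variable n : nat.
Implicit Types (m : 'I_n -> 'I_n) (s : 'S_n).

Definition hessenberg m : bool :=
  [forall i : 'I_n, i <= m i]%N &&
  [forall i : 'I_n, forall j : 'I_n, (i <= j)%N ==> (m i <= m j)%N].

Definition hess_perms m : {set 'S_n} :=
  [set s : 'S_n | [forall i : 'I_n, s i <= m i]%N].

(* [orbit s i] is the sequence i, s i, s (s i), ..., and [enum 'I_n] is
   increasing. *)
Definition cycles s : seq (seq 'I_n) :=
  [seq orbit s i | i <- enum 'I_n & [forall (j | j \in orbit s i), i <= j]%N].

Lemma perm_flatten_cycles s : perm_eq (flatten (cycles s)) (enum 'I_n).
Proof.
have sinj : injective s by exact: perm_inj.
set P := fun i : 'I_n => [forall (j | j \in orbit s i), i <= j]%N.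
have minE i j : P i -> P j -> fconnect s i j -> i = j.
  move=> /forall_inP Pi /forall_inP Pj cij; apply/val_inj/eqP.
  rewrite eqn_leq /= Pi -?fconnect_orbit //= Pj -?fconnect_orbit //.
  by rewrite fconnect_sym.
have uniq_fl (r : seq 'I_n) : uniq r -> all P r ->
    uniq (flatten [seq orbit s i | i <- r]).
  elim: r => //= i r IHr /andP[ir ur] /andP[Pi Pr].
  rewrite cat_uniq orbit_uniq IHr // andbT /=.
  apply/hasPn => x /flattenP[_ /mapP[j jr ->] xj].
  apply: contra ir => xi; suff -> : i = j by [].
  apply: minE (Pi) (allP Pr j jr) _; apply: (@connect_trans _ _ x).
    by rewrite fconnect_orbit.
  by rewrite fconnect_sym // fconnect_orbit.
apply: uniq_perm; rewrite ?enum_uniq //.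
  by apply: uniq_fl; [exact/filter_uniq/enum_uniq | exact: filter_all].
move=> x; rewrite mem_enum; apply/flattenP.
case: (@arg_minnP _ x (fun j => j \in orbit s x) (@nat_of_ord n) (in_orbit s x)).
move=> i xi mini.
exists (orbit s i); last by rewrite -fconnect_orbit fconnect_sym // fconnect_orbit.
apply/mapP; exists i => //; rewrite mem_filter mem_enum andbT.
apply/forall_inP => j ij; apply: mini.
by rewrite -fconnect_orbit; apply: (@connect_trans _ _ i); rewrite fconnect_orbit.
Qed.

Lemma one_line_inj s : injective (fun i : 'I_n => nth i (flatten (cycles s)) i).
Proof.
have E := perm_flatten_cycles s.
have sz : size (flatten (cycles s)) = n by rewrite (perm_size E) size_enum_ord.
have un : uniq (flatten (cycles s)) by rewrite (perm_uniq E) enum_uniq.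
move=> i j /eqP; rewrite (set_nth_default i) ?sz // nth_uniq ?sz //.
by move/eqP/val_inj.
Qed.

(* The permutation s^c, with one-line notation [flatten (cycles s)]. *)
Definition erase_par s : 'S_n := perm (@one_line_inj s).

Definition wt m s : nat :=
  #|[set p : 'I_n * 'I_n | (p.1 < p.2 <= m p.1)%N &&
      ((erase_par s)^-1%g p.2 < (erase_par s)^-1%g p.1)%N]|.

End Hessenberg.

(* Symmetric functions are represented by symmetric polynomials in N
   variables.  Restricting Lambda to N variables is an isomorphism in degrees
   at most N, where moreover the products e_lambda form a basis; so for a
   symmetric function of degree at most N nothing is lost. *)

Section SymmetricFunctions.
Variables (N : nat) (R : comNzRingType).
Implicit Types (f g p : {mpoly R[N]}) (la mu : seq nat).

Local Notation mes := (@mesym N R).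

Definition hsym (j : nat) : {mpoly R[N]} :=
  \sum_(u : 'X_{1..N < j.+1} | mdeg u == j) 'X_[u].

Definition hsyms : N.-tuple {mpoly R[N]} := [tuple hsym i.+1 | i < N].
Definition esyms : N.-tuple {mpoly R[N]} := [tuple mes i.+1 | i < N].

(* [symf f] is the unique polynomial t with f = t(e_1, ..., e_N), for f
   symmetric; omega is the algebra morphism e_i |-> h_i (i <= N).  It is an
   involution with h_j |-> e_j for j <= N, see [omega_h] and [omegaK]. *)
Definition omega f : {mpoly R[N]} := symf f \mPo hsyms.

Definition is_partition la : bool := sorted geq la && (0 \notin la)%N.

Definition epart la : {mpoly R[N]} := \prod_(i <- la) mes i.

Definition mults la : 'X_{1..N} := [multinom count_mem i.+1 la | i < N].

(* Coefficient of e_la in the expansion of f; parts equal to 0 are ignored,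
   in accordance with e_0 = 1. *)
Definition ecoef f la : R := (symf f)@_(mults la).

Definition part_of (u : 'X_{1..N}) : seq nat :=
  sort geq (flatten [seq nseq (u i) i.+1 | i <- enum 'I_N]).

Lemma hsym_coeff j u : (hsym j)@_u = (mdeg u == j)%:R.
Proof.
rewrite /hsym raddf_sum /=; have [E|ne] := eqVneq (mdeg u) j; last first.
  rewrite big1 // => v /eqP dv; rewrite mcoeffX.
  by case: eqP => // E; rewrite -E dv eqxx in ne.
have lt : (mdeg u < j.+1)%N by rewrite E.
rewrite (bigD1 (BMultinom lt)) /=; last by rewrite E.
rewrite mcoeffX eqxx big1 ?addr0 // => v /andP[_ ne].
rewrite mcoeffX; case: eqP => // E'; case/eqP: ne; exact: val_inj.
Qed.

Lemma hsym0 : hsym 0 = 1.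
Proof. by apply/mpolyP => u; rewrite hsym_coeff mcoeff1 mdeg_eq0. Qed.

Lemma hsym_sym j : hsym j \is symmetric.
Proof.
by apply/issymP => s; apply/mpolyP => u; rewrite mcoeff_sym !hsym_coeff mdeg_mperm.
Qed.

Lemma epart_sym la : epart la \is symmetric.
Proof. by apply: rpred_prod => i _; apply: mesym_sym. Qed.

Lemma symfE (t : {mpoly R[N]}) : symf (t \mPo esyms) = t.
Proof.
apply: msym_fundamental_un; rewrite -symfP //.
by apply: mcomp_sym => i; rewrite -tnth_nth tnth_mktuple mesym_sym.
Qed.

Lemma symf_ex f : f \is symmetric -> exists t, f = t \mPo esyms.
Proof. by move=> fs; exists (symf f); exact: symfP. Qed.

Lemma omega_comp (t : {mpoly R[N]}) : omega (t \mPo esyms) = t \mPo hsyms.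
Proof. by rewrite /omega symfE. Qed.

Lemma omega1 : omega 1 = 1.
Proof. by rewrite -[X in omega X](comp_mpoly1 esyms) omega_comp comp_mpoly1. Qed.

Lemma omegaP c f g : f \is symmetric -> g \is symmetric ->
  omega (c *: f + g) = c *: omega f + omega g.
Proof.
by move=> /symf_ex[t ->] /symf_ex[u ->]; rewrite -linearP /= !omega_comp linearP.
Qed.

Lemma omegaM f g : f \is symmetric -> g \is symmetric ->
  omega (f * g) = omega f * omega g.
Proof.
by move=> /symf_ex[t ->] /symf_ex[u ->]; rewrite -rmorphM /= !omega_comp rmorphM.
Qed.

Lemma omega_e j : (j <= N)%N -> omega (mes j) = hsym j.
Proof.
case: j => [|j] jN; first by rewrite mesym0E omega1 hsym0.
pose i := Ordinal jN.
have -> : mes j.+1 = 'X_i \mPo esyms by rewrite comp_mpolyXU -tnth_nth tnth_mktuple.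
by rewrite omega_comp comp_mpolyXU -tnth_nth tnth_mktuple.
Qed.

Lemma mcoeff_mulX (v : 'X_{1..N}) p u :
  ('X_[v] * p)@_u = if (v <= u)%MM then p@_(u - v) else 0.
Proof.
case: ifP => [le|nle]; first by rewrite mulrC -{1}(submK le) addmC mcoeffMX.
rewrite mcoeffM big1 // => k /eqP E; rewrite mcoeffX.
case: eqP => [E'|_]; last by rewrite mul0r.
by rewrite E -E' lem_addr in nle.
Qed.

Lemma sum_eh d : (0 < d)%N ->
  \sum_(i < d.+1) (-1) ^+ i * mes i * hsym (d - i) = 0.
Proof.
move=> d0; apply/mpolyP => u; rewrite mcoeff0 raddf_sum /=.
pose A : {set 'I_N} := [set i | u i != 0%N].
pose F (S : {set 'I_N}) : R :=
  if (mesym1 S <= u)%MM && (mdeg u == d) then (-1) ^+ #|S| else 0.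
have leA S : (mesym1 S <= u)%MM = (S \subset A).
  apply/mnm_lepP/subsetP => [le i iS|sub i].
    by rewrite inE -lt0n; have := le i; rewrite mnmE iS.
  by rewrite mnmE; case: (boolP (i \in S)) => // /sub; rewrite inE lt0n.
have step (i : 'I_d.+1) : ((-1) ^+ i * mes i * hsym (d - i))@_u
    = \sum_(S : {set 'I_N} | #|S| == i) F S.
  rewrite -mulrA -(rmorphN1 (@mpolyC N R)) -rmorphXn mcoeffCM /= mesymE.
  rewrite mulr_suml raddf_sum mulr_sumr /=; apply: eq_bigr => S /eqP cS.
  rewrite mcoeff_mulX hsym_coeff /F; case: ifP => le /=; last by rewrite mulr0.
  have -> : mdeg u = (mdeg (u - mesym1 S)%MM + i)%N.
    by rewrite -{1}(submK le) mdegD mdeg_mesym1 cS.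
  have iled : (i <= d)%N by rewrite -ltnS.
  have -> : (mdeg (u - mesym1 S)%MM == d - i)%N
            = (mdeg (u - mesym1 S)%MM + i == d)%N.
    by rewrite -(eqn_add2r i) subnK.
  by case: ifP; rewrite ?mulr1 ?mulr0 // cS.
rewrite (eq_bigr _ (fun i _ => step i)).
case: (eqVneq (mdeg u) d) => [du|ne]; last first.
  by rewrite big1 // => i _; rewrite big1 // => S _; rewrite /F (negbTE ne) andbF.
have SF (S : {set 'I_N}) : (d < #|S|)%N -> F S = 0.
  rewrite /F -du -mdeg_mesym1; case: ifP => // /andP[le _].
  by rewrite -{1}(submK le) mdegD ltnNge leq_addl.
transitivity (\sum_(S : {set 'I_N}) F S).
  rewrite [RHS](bigID (fun S : {set 'I_N} => #|S| < d.+1)%N) /=.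
  rewrite [X in _ = _ + X]big1 ?addr0; last by move=> S; rewrite -leqNgt => /SF.
  rewrite (partition_big (fun S : {set 'I_N} => inord #|S| : 'I_d.+1) predT) //=.
  apply: eq_bigr => i _; apply: eq_bigl => S.
  apply/eqP/andP => [->|[lt /eqP <-]]; last by rewrite inordK.
  by rewrite ltn_ord; split => //; apply/eqP/val_inj; rewrite /= inordK.
have [i iA] : exists i, i \in A.
  apply/existsP; apply: contraTT d0; rewrite negb_exists => /forallP A0.
  rewrite -du mdegE big1 // => i _.
  by have := A0 i; rewrite inE negbK => /eqP.
transitivity (\prod_(j : 'I_N) (- (j \in A)%:R + 1 : R)); last first.
  by rewrite (bigD1 i) //= iA addNr mul0r.
rewrite bigA_distr /=; apply: eq_bigr => S _.
rewrite -big_mkcond /= /F leA du eqxx andbT.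
case: ifP => [sub|/negbT/subsetPn[j jS jA]].
  rewrite (eq_bigr (fun=> -1)) ?prodr_const // => j jS.
  by rewrite (subsetP sub).
by rewrite (bigD1 j) //= (negbTE jA) oppr0 mul0r.
Qed.

Lemma sum_he d : (0 < d)%N ->
  \sum_(i < d.+1) (-1) ^+ i * hsym i * mes (d - i) = 0.
Proof.
move=> d0; rewrite (reindex_inj rev_ord_inj) /=.
have /(congr1 ( *%R ((-1) ^+ d))) := sum_eh d0; rewrite mulr0 => {2}<-.
rewrite mulr_sumr; apply: eq_bigr => i _; rewrite subSS.
have id : (i <= d)%N by rewrite -ltnS.
have -> : (-1) ^+ (d - i) = (-1) ^+ d * (-1) ^+ i :> {mpoly R[N]}.
  have -> : (-1) ^+ d = (-1) ^+ (d - i + i) :> {mpoly R[N]} by rewrite subnK.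
  by rewrite exprD -mulrA -exprMn mulrNN mulr1 expr1n mulr1.
by rewrite subKn // -!mulrA [hsym _ * _]mulrC.
Qed.

Lemma omega_h j : (j <= N)%N -> omega (hsym j) = mes j.
Proof.
have rec (a b : nat -> {mpoly R[N]}) d : b 0 = 1 ->
    \sum_(i < d.+2) (-1) ^+ i * b i * a (d.+1 - i)%N = 0 ->
    a d.+1 = \sum_(i < d.+1) ((-1) ^+ i : R) *: (b i.+1 * a (d - i)%N).
  move=> b0; rewrite big_ord_recl /= expr0 b0 !mul1r subn0 => /eqP.
  rewrite addr_eq0 => /eqP ->; rewrite -sumrN; apply: eq_bigr => i _.
  rewrite /bump /= add1n exprS mulN1r !mulNr opprK subSS -mulrA.
  by rewrite -mul_mpolyC rmorphXn rmorphN1.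
elim/ltn_ind: j => -[|d] IH dN; first by rewrite hsym0 omega1 mesym0E.
have os (I : seq 'I_d.+1) (G : 'I_d.+1 -> {mpoly R[N]}) (c : 'I_d.+1 -> R) :
    (forall i, G i \is symmetric) ->
    omega (\sum_(i <- I) c i *: G i) = \sum_(i <- I) c i *: omega (G i).
  move=> Gs; elim: I => [|i I IHI].
    by rewrite !big_nil -[X in omega X](comp_mpoly0 esyms) omega_comp comp_mpoly0.
  by rewrite !big_cons omegaP ?IHI // rpred_sum // => k _; rewrite rpredZ.
rewrite (rec hsym mes d (mesym0E _ _) (@sum_eh d.+1 isT)).
rewrite (rec mes hsym d hsym0 (@sum_he d.+1 isT)).
rewrite os => [|i]; last by rewrite rpredM ?mesym_sym ?hsym_sym.
apply: eq_bigr => i _; have il : (i < d.+1)%N := ltn_ord i.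
rewrite omegaM ?mesym_sym ?hsym_sym // omega_e ?(leq_trans il) //.
by rewrite IH // ?ltnS ?leq_subr // (leq_trans (leq_subr _ _)) // ltnW.
Qed.

Lemma omegaK f : f \is symmetric -> omega (omega f) = f.
Proof.
have os (I : seq 'X_{1..N}) (G : 'X_{1..N} -> {mpoly R[N]}) (c : 'X_{1..N} -> R) :
    (forall i, G i \is symmetric) ->
    omega (\sum_(i <- I) c i *: G i) = \sum_(i <- I) c i *: omega (G i).
  move=> Gs; elim: I => [|i I IHI].
    by rewrite !big_nil -[X in omega X](comp_mpoly0 esyms) omega_comp comp_mpoly0.
  by rewrite !big_cons omegaP ?IHI // rpred_sum // => k _; rewrite rpredZ.
have hs i : tnth hsyms i \is symmetric by rewrite tnth_mktuple hsym_sym.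
have oX (I : seq 'I_N) (u : 'X_{1..N}) :
    omega (\prod_(i <- I) tnth hsyms i ^+ u i) = \prod_(i <- I) tnth esyms i ^+ u i.
  elim: I => [|i I IHI]; first by rewrite !big_nil omega1.
  rewrite !big_cons omegaM ?IHI ?rpredX ?rpred_prod //; last first.
    by move=> k _; rewrite rpredX.
  congr (_ * _); elim: (u i) => [|k IHk]; first by rewrite !expr0 omega1.
  by rewrite !exprS omegaM ?rpredX // IHk !tnth_mktuple omega_h.
move=> /symf_ex[t ->]; rewrite omega_comp !comp_mpolyE os.
  by apply: eq_bigr => u _; rewrite oX.
by move=> u; rewrite rpred_prod // => i _; rewrite rpredX.
Qed.

Lemma part_of_partition u : is_partition (part_of u).
Proof.
rewrite /is_partition sort_sorted /=; last by move=> i j; apply: leq_total.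
by rewrite mem_sort; apply/flattenP => -[_ /mapP[i _ ->]] /nseqP[].
Qed.

Lemma part_of_leN u : all (fun i => i <= N)%N (part_of u).
Proof.
apply/allP => i; rewrite mem_sort => /flattenP[_ /mapP[j _ ->]] /nseqP[-> _].
exact: ltn_ord.
Qed.

Lemma mults_part_of u : mults (part_of u) = u.
Proof.
apply/mnmP => i; rewrite mnmE.
rewrite (seq.permP (permEl (perm_sort _ _))) count_flatten -map_comp sumnE big_map.
rewrite big_enum /= (bigD1 i) //= count_nseq /= eqxx mul1n big1 ?addn0 // => j ne.
by rewrite count_nseq /= eqSS (inj_eq val_inj) (negbTE ne).
Qed.

Lemma epartE la : all (fun i => i <= N)%N la ->
  epart la = 'X_[mults la] \mPo esyms.
Proof.
elim: la => [|j la IH] /=.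
  have -> : mults [::] = 0%MM by apply/mnmP => i; rewrite !mnmE.
  by rewrite /epart big_nil mpolyX0 comp_mpoly1.
move=> /andP[jN /IH E]; rewrite /epart big_cons -/(epart la) E.
case: j jN => [|j] jN.
  have -> : mults (0%N :: la) = mults la by apply/mnmP => i; rewrite !mnmE.
  by rewrite mesym0E mul1r.
have -> : mults (j.+1 :: la) = (U_(Ordinal jN) + mults la)%MM.
  by apply/mnmP => i; rewrite mnmDE mnm1E !mnmE /= eqSS -val_eqE.
by rewrite mpolyXD rmorphM /= comp_mpolyXU -tnth_nth tnth_mktuple.
Qed.

Lemma ecoef_expansion f : f \is symmetric ->
  f = \sum_(u <- msupp (symf f)) ecoef f (part_of u) *: epart (part_of u).
Proof.
move=> fs; rewrite {1}(symfP fs) comp_mpolyEX; apply: eq_bigr => u _.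
by rewrite epartE ?part_of_leN // /ecoef mults_part_of.
Qed.

Lemma mults_inj la mu : is_partition la -> is_partition mu ->
  all (fun i => i <= N)%N la -> all (fun i => i <= N)%N mu ->
  mults la = mults mu -> la = mu.
Proof.
move=> /andP[sla la0] /andP[smu mu0] laN muN /mnmP E.
apply: (@sorted_eq _ geq) => //.
- by move=> i j k ij ki; apply: leq_trans ij.
- by move=> i j ij; apply/eqP; rewrite eqn_leq andbC.
apply/allP => -[|i] _ /=; first by rewrite !(count_memPn _).
have [iN|Ni] := ltnP i N; first by have := E (Ordinal iN); rewrite !mnmE => ->.
have out nu : all (fun i => i <= N)%N nu -> i.+1 \notin nu.
  by move=> nuN; apply/negP => /(allP nuN); rewrite /= ltnNge Ni.
by rewrite !(count_memPn _) ?out.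
Qed.

Lemma ecoef_sum (s : seq (seq nat)) (c : seq nat -> R) mu :
  uniq s -> all is_partition s -> all (all (fun i => i <= N)%N) s -> mu \in s ->
  ecoef (\sum_(la <- s) c la *: epart la) mu = c mu.
Proof.
move=> us ps sN mus.
have -> : \sum_(la <- s) c la *: epart la
    = (\sum_(la <- s) c la *: 'X_[mults la]) \mPo esyms.
  rewrite linear_sum; apply: eq_big_seq => la las /=.
  by rewrite comp_mpolyZ epartE ?(allP sN).
rewrite /ecoef symfE raddf_sum (bigD1_seq mu) //= mcoeffZ mcoeffX eqxx mulr1.
rewrite big_seq_cond big1 ?addr0 // => la /andP[las ne]; rewrite mcoeffZ mcoeffX.
case: eqP => [E|_]; last by rewrite mulr0.
by case/eqP: ne; apply: mults_inj E; rewrite ?(allP ps) ?(allP sN).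
Qed.

End SymmetricFunctions.

(* The coefficient ring is rat[q], with q = 'X. *)
Section Rho.
Variable N : nat.
Local Notation hs := (@hsym N {poly rat}).

Definition qint (n : nat) : {poly rat} := \sum_(i < n) 'X^i.

(* [:: rho_0; ...; rho_n], with the junk value rho_0 = 0 *)
Fixpoint rho_seq (n : nat) : seq {mpoly {poly rat}[N]} :=
  if n is n'.+1 then
    let r := rho_seq n' in
    rcons r (qint n *: hs n - \sum_(1 <= i < n) hs i * r`_(n - i))
  else [:: 0].

Definition rho (n : nat) : {mpoly {poly rat}[N]} := (rho_seq n)`_n.

Lemma rhoE n : (0 < n)%N ->
  qint n *: hs n = \sum_(0 <= i < n) hs i * rho (n - i).
Proof.
have sz k : size (rho_seq k) = k.+1 by elim: k => //= k IH; rewrite size_rcons IH.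
have st k j : (j <= k)%N -> (rho_seq k)`_j = rho j.
  elim: k => [|k IH]; first by rewrite leqn0 => /eqP ->.
  rewrite leq_eqVlt => /predU1P[-> //|jk].
  by rewrite /= nth_rcons sz jk IH.
case: n => // n _; rewrite big_ltn // hsym0 mul1r subn0.
rewrite {1}/rho /= nth_rcons sz ltnn eqxx.
rewrite [X in _ - X + _](_ : _ = \sum_(1 <= i < n.+1) hs i * rho (n.+1 - i)).
  by rewrite subrK.
apply: eq_big_nat => -[|i] // /andP[_ il].
by rewrite st // subSS leq_subr.
Qed.

End Rho.

Section G.
Variables (N n : nat) (m : 'I_n -> 'I_n) (k : nat).

Definition gk : {mpoly {poly rat}[N]} :=
  \sum_(s in hess_perms m | (n - k <= size (head [::] (cycles s)))%N)
    let d := (size (head [::] (cycles s)) + k - n)%N in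
    ((-1) ^+ d * 'X^(wt m s)) *:
      (hsym N {poly rat} d *
       omega (\prod_(t <- behead (cycles s)) rho N (size t))).

Definition gk_at1 : {mpoly rat[N]} := map_mpoly (horner_eval 1) gk.

End G.

(* Main.v *)
Require Import Defs.
From mathcomp Require Import all_boot all_order fingroup perm all_algebra zify.
From mathcomp.multinomials Require Import mpoly.
(* Imported last so that [order] is [fingraph.order]. *)
From mathcomp Require Import fingraph.

(* Extracting the coefficient of e_k is a derivation, hence kills products of
   two factors of positive degree.  It is (-1)^(k-1) on h_k and k on
   omega(rho_k) at q = 1, so for k > 0 the coefficient in question is
     k * #{s in S_{n,m} : s has two cycles, the one avoiding 1 of length k}
       - #{n-cycles in S_{n,m}}.
   To see that it is nonnegative, write an n-cycle s as the word W_0 = 1,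
   W_{j+1} = s W_j, and let p < n - k be the last place where W_{p+1} <=
   m(W_{p+k}), that is, where the factor W_{p+1} ... W_{p+k} closes up to a cycle
   (p = 0 is such a place since W_0 is minimal).  Maximality of p and
   monotonicity of m ensure that the rest of the word closes up as well, which
   gives a permutation t with two cycles.  Mark in the new k-cycle the letter W_q
   with q a multiple of k.  Then (t, W_q) determines s: if s and s' yield the
   same pair with p < p', the failures to close at p + 1, p + 2, ... in s force
   W_j <= t^j W_q for all j > p, and together with the failure at p' this
   contradicts the fact that s' maps t^p' 1 to t^(p'+1) W_q. *)

Set Implicit Arguments.
Unset Strict Implicit.
Unset Printing Implicit Defensive.

(** * Orders and periods of iterated maps *)

Lemma order_iter (T : finType) (f : T -> T) (x : T) (l : nat) :
  (0 < l)%N -> iter l f x = x ->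
  (forall i j, (i < l)%N -> (j < l)%N -> iter i f x = iter j f x -> i = j) ->
  order f x = l.
Proof.
case: l => // l _ fx inj_it.
have cyc : fcycle f (traject f x l.+1).
  rewrite /= -[X in rcons _ X]fx iterSr -trajectSr.
  exact: fpath_traject.
rewrite -[RHS](size_traject f x); apply: order_cycle => //.
  apply/(uniqP x) => i j; rewrite !inE !size_traject => il jl.
  by rewrite !nth_traject //; apply: inj_it.
by rewrite /= mem_head.
Qed.

Lemma iter_period (T : Type) (f : T -> T) (x : T) (l c : nat) :
  iter l f x = x -> iter (c * l) f x = x.
Proof. by move=> fx; elim: c => // c IH; rewrite mulSn iterD IH. Qed.

(** * Cutting an n-cycle into two cycles *)

Section Cut.
Variables (n : nat) (s : 'S_n.+1) (p k : nat).
Hypotheses (full : order s ord0 = n.+1) (k_gt0 : (0 < k)%N) (pk : (p + k < n.+1)%N).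

Local Notation W := (fun j => iter j s ord0).

(** Products of permutations act from left to right, so [s] comes after the transposition and the
    images of W_p and W_{p+k} are exchanged. The cycle splits into (W_0 ... W_p W_{p+k+1} ... W_n)
    and (W_{p+1} ... W_{p+k}). *)
Definition cut : 'S_n.+1 := (tperm (W p) (W (p + k)) * s)%g.
Local Notation t := cut.

Lemma full_inj i j : (i < n.+1)%N -> (j < n.+1)%N -> W i = W j -> i = j.
Proof.
by move=> il jl E; rewrite -(@findex_iter _ s ord0 i) ?full // E findex_iter ?full.
Qed.

Lemma full_iter : W n.+1 = ord0.
Proof. by have := iter_order (@perm_inj _ s) ord0; rewrite full. Qed.

Lemma full_surj x : exists2 j, (j < n.+1)%N & x = W j.
Proof.
pose g (i : 'I_n.+1) : 'I_n.+1 := W i.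
have gi : injective g by move=> i j /full_inj E; apply/val_inj/E.
have [h hK gK] := injF_bij gi.
by exists (h x) => //; rewrite -[LHS]gK.
Qed.

Lemma cutL : t (W p) = W (p + k).+1.
Proof. by rewrite permM tpermL. Qed.

Lemma cutR : t (W (p + k)) = W p.+1.
Proof. by rewrite permM tpermR. Qed.

Lemma cutD j : (j < n.+1)%N -> j != p -> j != (p + k)%N -> t (W j) = W j.+1.
Proof.
move=> jn jp jpk; rewrite permM tpermD //.
  by apply: contra jp => /eqP/full_inj E; rewrite E //; lia.
by apply: contra jpk => /eqP/full_inj E; rewrite E //; lia.
Qed.

Lemma iter_cut_before j : (j <= p)%N -> iter j t ord0 = W j.
Proof. by elim: j => // j IH jp; rewrite iterS IH ?cutD //; lia. Qed.

Lemma iter_cut_after j : (p < j)%N -> (j + k <= n.+1)%N ->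
  iter j t ord0 = W (j + k).
Proof.
elim: j => // j IH pj jn; rewrite iterS.
have [E|ne] := eqVneq j p; first by rewrite E iter_cut_before // cutL.
by rewrite IH ?cutD ?addSn //; lia.
Qed.

Lemma iter_cut_in j : (j < k)%N -> iter j t (W p.+1) = W (p.+1 + j).
Proof.
elim: j => [|j IH] jk; first by rewrite addn0.
by rewrite iterS IH ?cutD ?addnS //; lia.
Qed.

Lemma iter_cut_period : iter k t (W p.+1) = W p.+1.
Proof.
case: k k_gt0 cutR iter_cut_in => // l _ R E.
by rewrite iterS E // addSnnS R.
Qed.

Lemma order_cut0 : order t ord0 = (n.+1 - k)%N.
Proof.
apply: order_iter; first lia.
  by rewrite iter_cut_after ?subnK ?full_iter //; lia.
(* [g] gives the position in the word of [s] of the j-th letter of the first new cycle: it skips the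
   block that was cut out. *)
pose g j := if (j <= p)%N then j else (j + k)%N.
have gE j : (j < n.+1 - k)%N -> iter j t ord0 = W (g j).
  rewrite /g => jn; case: leqP => jp; first by rewrite iter_cut_before.
  by rewrite iter_cut_after //; lia.
move=> i j il jl; rewrite !gE // => /full_inj.
by rewrite /g; case: (leqP i p) => ip; case: (leqP j p) => jp; lia.
Qed.

Lemma order_cut_in : order t (W p.+1) = k.
Proof.
apply: order_iter iter_cut_period _ => // i j ik jk.
by rewrite !iter_cut_in // => /full_inj; lia.
Qed.

Lemma cut_orbits x : x \notin orbit t ord0 -> order t x = k.
Proof.
have tI : injective t by apply: perm_inj.
have [j jn ->] := full_surj x; rewrite -fconnect_orbit => nc.
have [jp|pj] := leqP j p.
  by case/negP: nc; rewrite -iter_cut_before // fconnect_iter.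
have [jpk|pkj] := leqP j (p + k); last first.
  case/negP: nc; have -> : j = (j - k + k)%N by lia.
  by rewrite -iter_cut_after ?fconnect_iter //; lia.
rewrite -order_cut_in; apply: eq_order_cycle (cycle_orbit tI (W p.+1)) _ _ _ _.
  exact: in_orbit.
rewrite -fconnect_orbit; have -> : j = (p.+1 + (j - p.+1))%N by lia.
by rewrite -iter_cut_in ?fconnect_iter //; lia.
Qed.

(* The unique multiple of [k] in the interval [p + 1, p + k]. *)
Definition mark : nat := ((p + k) %/ k * k)%N.

Lemma markP : (p < mark <= p + k)%N.
Proof.
rewrite /mark; have := divn_eq (p + k) k; have := ltn_pmod (p + k) k_gt0; lia.
Qed.

(** The block has period [k] under [t] and [mark] is a multiple of [k], so j steps from the marked
    letter lead to the position of the block congruent to j modulo [k]. Thus the marked letter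
    indexes the block by the positions of the original word. *)
Lemma iter_cut_mark j : (p < j <= p + k)%N -> iter j t (W mark) = W j.
Proof.
have /andP[mp mk] := markP => /andP[jp jk].
have -> : W mark = iter (mark - p.+1) t (W p.+1).
  by rewrite iter_cut_in ?subnKC //; lia.
rewrite -iterD; have -> : (j + (mark - p.+1) = j - p.+1 + mark)%N by lia.
rewrite iterD (iter_period _ iter_cut_period) iter_cut_in; last lia.
by rewrite subnKC.
Qed.

Lemma mark_period : iter k t (W mark) = W mark.
Proof.
have /andP[mp mk] := markP.
have -> : W mark = iter (mark - p.+1) t (W p.+1).
  by rewrite iter_cut_in ?subnKC //; lia.
by rewrite -iterD addnC iterD iter_cut_period.
Qed.

Lemma mark_notin : W mark \notin orbit t ord0.
Proof.
apply/negP => /trajectP[j]; rewrite order_cut0 => jn.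
have /andP[mp mk] := markP.
have [jp|pj] := leqP j p.
  by rewrite iter_cut_before // => /full_inj; lia.
by rewrite iter_cut_after //; [move=> /full_inj|]; lia.
Qed.

End Cut.

(** * Comparing the numbers of n-cycles and of marked bicycles *)

Section Count.
Variables (n : nat) (m : 'I_n.+1 -> 'I_n.+1) (m_hess : hessenberg m) (k : nat).
Hypotheses (k_gt0 : (0 < k)%N) (k_lt_n : (k < n.+1)%N).

Lemma hess_mono (x y : 'I_n.+1) : (x <= y)%N -> (m x <= m y)%N.
Proof. by case/andP: m_hess => _ /forallP/(_ x)/forallP/(_ y)/implyP. Qed.

Definition full_cycles : {set 'S_n.+1} :=
  [set s in hess_perms m | order s ord0 == n.+1].

(** Only [k] points lie outside the orbit of [ord0], so for positive [k] the last condition makes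
    them a single cycle. *)
Definition bicycles : {set 'S_n.+1} :=
  [set t in hess_perms m | (order t ord0 == n.+1 - k)%N &&
    [forall x, (x \notin orbit t ord0) ==> (order t x == k)]].

Definition closable (s : 'S_n.+1) (j : nat) : bool :=
  (j + k < n.+1)%N && (iter j.+1 s ord0 <= m (iter (j + k) s ord0))%N.

(* The last place where the [k] letters that follow close up to a cycle. *)
Definition cut_pos (s : 'S_n.+1) : 'I_n.+1 :=
  [arg max_(j > ord0 | closable s j) (j : nat)].

Lemma full_cyclesP s : s \in full_cycles ->
  (forall x, s x <= m x)%N /\ order s ord0 = n.+1.
Proof. by rewrite !inE => /andP[/forallP ? /eqP]. Qed.

Lemma cut_posP s : s \in full_cycles ->
  closable s (cut_pos s) /\
  forall j, (cut_pos s < j)%N -> (j + k < n.+1)%N ->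
    (m (iter (j + k) s ord0) < iter j.+1 s ord0)%N.
Proof.
move=> /full_cyclesP[sm full]; rewrite /cut_pos; case: arg_maxnP.
  (* Position 0 is closable: W_1 <= m(W_0) <= m(W_k), since W_0 is the least element. *)
  by rewrite /closable add0n k_lt_n; apply: leq_trans (sm _) (hess_mono _).
move=> p cp pmax; split=> // j pj jk; rewrite ltnNge; apply/negP => cj.
have jn : (j < n.+1)%N by lia.
have := pmax (Ordinal jn); rewrite /closable jk => /(_ cj) /=.
by rewrite leqNgt pj.
Qed.

Lemma cut_pos_lt s : s \in full_cycles -> (cut_pos s + k < n.+1)%N.
Proof. by move=> /cut_posP[/andP[]]. Qed.

(** Otherwise W_j <= W_{j+k}, hence W_{j+1} <= m(W_j) <= m(W_{j+k}), and j would be a closable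
    position beyond the last one. *)
Lemma descent s j : s \in full_cycles -> (cut_pos s < j)%N -> (j + k < n.+1)%N ->
  (iter (j + k) s ord0 < iter j s ord0)%N.
Proof.
move=> sF pj jk; have [_ /(_ j pj jk) lt] := cut_posP sF.
have [sm _] := full_cyclesP sF.
rewrite ltnNge; apply/negP => /hess_mono le.
have := sm (iter j s ord0); rewrite -iterS; lia.
Qed.

(** Only two images change. That of W_{p+k} is allowed since p is closable. That of W_p is
    W_{p+k+1}, which is [ord0] if the block ends the word. Otherwise, W_{p+k+1} > m(W_p) >= W_{p+1}
    would give W_{p+2} <= m(W_{p+1}) <= m(W_{p+1+k}), making p + 1 closable. *)
Lemma cut_hess s : s \in full_cycles -> cut s (cut_pos s) k \in hess_perms m.
Proof.
move=> sF; have [sm full] := full_cyclesP sF.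
have [/andP[pk cl] bad] := cut_posP sF.
set p : nat := cut_pos s in pk cl bad *.
rewrite inE; apply/forallP => x; have [j jn ->] := full_surj full x.
have [->|jp] := eqVneq j p; last first.
  have [->|jpk] := eqVneq j (p + k)%N; first by rewrite cutR.
  by rewrite cutD // iterS sm.
rewrite cutL; have [E|ne] := eqVneq (p + k)%N n.
  by rewrite E full_iter.
have lt : (p.+1 + k < n.+1)%N by lia.
rewrite leqNgt; apply/negP => gt.
have := bad p.+1 (ltnSn p) lt; rewrite addSn.
have := hess_mono (leq_trans (sm (iter p s ord0)) (ltnW gt)).
have := sm (iter p.+1 s ord0); rewrite -!iterS; lia.
Qed.

Lemma cut_bicycle s : s \in full_cycles -> cut s (cut_pos s) k \in bicycles.
Proof.
move=> sF; have [sm full] := full_cyclesP sF; have pk := cut_pos_lt sF.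
rewrite inE cut_hess // order_cut0 // eqxx /=.
by apply/forallP => x; apply/implyP => xo; rewrite cut_orbits.
Qed.

Definition cut_mark (s : 'S_n.+1) : 'S_n.+1 * 'I_n.+1 :=
  (cut s (cut_pos s) k, iter (mark (cut_pos s) k) s ord0).

Lemma cut_mark_pos s s' : s \in full_cycles -> s' \in full_cycles ->
  cut_mark s = cut_mark s' -> (cut_pos s' <= cut_pos s)%N.
Proof.
move=> sF sF' [E1 E2]; have [sm full] := full_cyclesP sF.
have [sm' full'] := full_cyclesP sF'.
have pk := cut_pos_lt sF; have pk' := cut_pos_lt sF'.
have [_ bad] := cut_posP sF.
rewrite leqNgt; apply/negP => lt.
set p : nat := cut_pos s in pk bad lt E1 E2; set p' : nat := cut_pos s' in pk' lt E1 E2.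
pose t := cut s p k; pose y := iter (mark p k) s ord0.
(* Equality holds inside the block. Beyond it, going back by [k] raises the letter of [s] by
   [descent] and leaves the iterate of y unchanged, as y has period [k]. *)
have chain q : (p < q)%N -> (q < n.+1)%N -> (iter q s ord0 <= iter q t y)%N.
  elim/ltn_ind: q => q IH pq qn; have [qk|kq] := leqP q (p + k).
    by rewrite iter_cut_mark ?pq.
  have Eq : q = (q - k + k)%N by lia.
  rewrite [in leqRHS]Eq iterD mark_period //.
  apply: leq_trans (IH (q - k)%N _ _ _); try lia.
  by rewrite [in leqLHS]Eq; apply/ltnW/descent => //; rewrite -?/p; lia.
(* With W' the word of [s'], the letter W_{p'+k} equals t^p' 0 = W'_{p'}, so the failure at p' reads
   m(W'_{p'}) < W_{p'+1}. But [chain] gives W_{p'+1} <= t^(p'+1) y = W'_{p'+1} <= m(W'_{p'}). *)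
have := bad p' lt pk'; rewrite -(iter_cut_after full k_gt0 pk) //; last lia.
rewrite E1 iter_cut_before //.
have := chain p'.+1; rewrite /t /y E1 E2 iter_cut_mark ?leqnSn //; last lia.
have := sm' (iter p' s' ord0); rewrite -iterS; lia.
Qed.

Lemma cut_mark_inj : {in full_cycles &, injective cut_mark}.
Proof.
move=> s s' sF sF' E; have [_ full] := full_cyclesP sF.
have [_ full'] := full_cyclesP sF'.
have Ep : cut_pos s = cut_pos s' :> nat.
  by apply/eqP; rewrite eqn_leq !cut_mark_pos.
have pk := cut_pos_lt sF; have pk' := cut_pos_lt sF'.
case: E => E1 E2.
(* Once p is known, each letter of the word is an iterate of the cut permutation at [ord0] or at the
   marked letter. *)
have Wn : forall s (sF : s \in full_cycles) j, (j < n.+1)%N ->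
  iter j s ord0 = if (j <= cut_pos s)%N then iter j (cut s (cut_pos s) k) ord0
    else if (j <= cut_pos s + k)%N then
      iter j (cut s (cut_pos s) k) (iter (mark (cut_pos s) k) s ord0)
    else iter (j - k) (cut s (cut_pos s) k) ord0.
  move=> {E1 E2 Ep pk pk' sF sF' s s' full full'} s sF j jn.
  have [_ full] := full_cyclesP sF; have pk := cut_pos_lt sF.
  case: leqP => jp; first by rewrite iter_cut_before.
  case: leqP => jpk; first by rewrite iter_cut_mark // jp.
  by rewrite iter_cut_after //; [congr (iter _ _ _)|..]; lia.
have EW j : (j <= n.+1)%N -> iter j s ord0 = iter j s' ord0.
  rewrite leq_eqVlt => /predU1P[->|jn]; first by rewrite !full_iter.
  by rewrite (Wn s) // (Wn s') // E1 E2 Ep.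
apply/permP => x; have [j jn ->] := full_surj full x.
by rewrite -iterS EW // iterS EW // ltnW.
Qed.

Lemma card_full_cycles : (#|full_cycles| <= k * #|bicycles|)%N.
Proof.
rewrite -(card_in_imset cut_mark_inj).
pose D := [set u : 'S_n.+1 * 'I_n.+1 | (u.1 \in bicycles) && (u.2 \notin orbit u.1 ord0)].
have sub : cut_mark @: full_cycles \subset D.
  apply/subsetP => _ /imsetP[s sF ->]; rewrite inE cut_bicycle //=.
  by have [_ full] := full_cyclesP sF; apply: mark_notin => //; apply: cut_pos_lt.
apply: leq_trans (subset_leq_card sub) _.
(* Each bicycle admits [k] marks, namely the points outside the orbit of [ord0]. *)
have -> : #|D| = \sum_(t in bicycles) \sum_(x | x \notin orbit t ord0) 1.
  by rewrite pair_big_dep -sum1_card; apply: eq_bigl => u; rewrite inE.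
rewrite mulnC -sum_nat_const; apply: leq_sum => t; rewrite inE => /and3P[_ /eqP o0 _].
rewrite sum1_card; have := cardC (mem (orbit t ord0)).
rewrite card_ord (card_uniqP (orbit_uniq _ _)) size_orbit o0.
rewrite (eq_card (B := [pred x | x \notin orbit t ord0])) //; lia.
Qed.

End Count.

Import Order.TTheory GRing.Theory Num.Theory.
Local Open Scope ring_scope.

(** * Constant and linear coefficients in the elementary basis *)

Section Ecoef.
Variables (N : nat) (R : comNzRingType).
Implicit Types (f g : {mpoly R[N]}) (la : seq nat).

(** On symmetric polynomials [symf] inverts the composition with [esyms], and so inherits its
    linearity. *)
Lemma symf_linearP c f g : f \is symmetric -> g \is symmetric ->
  symf (c *: f + g) = c *: symf f + symf g.
Proof.
by move=> /symf_ex[t ->] /symf_ex[u ->]; rewrite -linearP /= !symfE.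
Qed.

Lemma symfM f g : f \is symmetric -> g \is symmetric ->
  symf (f * g) = symf f * symf g.
Proof.
by move=> /symf_ex[t ->] /symf_ex[u ->]; rewrite -rmorphM /= !symfE.
Qed.

Lemma symf0 : symf (0 : {mpoly R[N]}) = 0.
Proof. by rewrite -[X in symf X](comp_mpoly0 (esyms N R)) symfE. Qed.

Lemma symf1 : symf (1 : {mpoly R[N]}) = 1.
Proof. by rewrite -[X in symf X](comp_mpoly1 (esyms N R)) symfE. Qed.

Lemma symfZ c f : f \is symmetric -> symf (c *: f) = c *: symf f.
Proof. by move=> fs; rewrite -[c *: f]addr0 symf_linearP ?rpred0 // symf0 addr0. Qed.

Lemma symfD f g : f \is symmetric -> g \is symmetric -> symf (f + g) = symf f + symf g.
Proof. by move=> fs gs; rewrite -[f]scale1r symf_linearP // !scale1r. Qed.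

Lemma symfN f : f \is symmetric -> symf (- f) = - symf f.
Proof. by move=> fs; rewrite -scaleN1r symfZ // scaleN1r. Qed.

Lemma symf_sum (I : Type) (r : seq I) (P : pred I) (F : I -> {mpoly R[N]}) :
  (forall i, P i -> F i \is symmetric) ->
  symf (\sum_(i <- r | P i) F i) = \sum_(i <- r | P i) symf (F i).
Proof.
move=> Fs; elim: r => [|i r IH]; first by rewrite !big_nil symf0.
rewrite !big_cons; case: ifP => // Pi.
by rewrite symfD ?IH ?Fs // rpred_sum.
Qed.

Lemma symf_mesym (i : 'I_N) : symf (mesym N R i.+1) = 'X_i.
Proof.
have <- : 'X_i \mPo esyms N R = mesym N R i.+1 by rewrite comp_mpolyXU -tnth_nth tnth_mktuple.
exact: symfE.
Qed.

Lemma ecoefZ c f la : f \is symmetric -> ecoef (c *: f) la = c * ecoef f la.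
Proof. by move=> fs; rewrite /ecoef symfZ // mcoeffZ. Qed.

Lemma ecoefD f g la : f \is symmetric -> g \is symmetric ->
  ecoef (f + g) la = ecoef f la + ecoef g la.
Proof. by move=> fs gs; rewrite /ecoef symfD // mcoeffD. Qed.

Lemma ecoefN f la : f \is symmetric -> ecoef (- f) la = - ecoef f la.
Proof. by move=> fs; rewrite /ecoef symfN // mcoeffN. Qed.

Lemma ecoef_sumr (I : Type) (r : seq I) (P : pred I) (F : I -> {mpoly R[N]}) la :
  (forall i, P i -> F i \is symmetric) ->
  ecoef (\sum_(i <- r | P i) F i) la = \sum_(i <- r | P i) ecoef (F i) la.
Proof. by move=> Fs; rewrite /ecoef symf_sum // raddf_sum. Qed.

Lemma mults_nil : mults N [::] = 0%MM.
Proof. by apply/mnmP => i; rewrite !mnmE. Qed.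

Lemma mults_seq1 (i : 'I_N) : mults N [:: i.+1] = U_(i)%MM.
Proof. by apply/mnmP => j; rewrite mnm1E !mnmE /= addn0 eqSS. Qed.

Lemma ecoef1_nil : ecoef (1 : {mpoly R[N]}) [::] = 1.
Proof. by rewrite /ecoef symf1 mults_nil mcoeff1 eqxx. Qed.

Lemma ecoefM_nil f g : f \is symmetric -> g \is symmetric ->
  ecoef (f * g) [::] = ecoef f [::] * ecoef g [::].
Proof. by move=> fs gs; rewrite /ecoef symfM // mults_nil rmorphM. Qed.

(** This is the Leibniz rule: the coefficient of X_i is the i-th partial derivative evaluated at
    0. *)
Lemma mcoeffM_U (p q : {mpoly R[N]}) (i : 'I_N) :
  (p * q)@_U_(i) = p@_U_(i) * q@_0%MM + p@_0%MM * q@_U_(i).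
Proof.
have dE (r : {mpoly R[N]}) : r@_U_(i) = (r^`M(i))@_0%MM.
  by rewrite mcoeff_deriv add0m mnmE.
by rewrite !dE mderivM mcoeffD !rmorphM.
Qed.

Lemma ecoefM_seq1 f g k : f \is symmetric -> g \is symmetric -> (0 < k <= N)%N ->
  ecoef (f * g) [:: k] = ecoef f [:: k] * ecoef g [::] + ecoef f [::] * ecoef g [:: k].
Proof.
case: k => // k fs gs kN; pose i := Ordinal kN.
by rewrite /ecoef symfM // mults_nil -[k]/(nat_of_ord i) mults_seq1 mcoeffM_U.
Qed.

Lemma ecoef_mesym_nil j : (0 < j <= N)%N -> ecoef (mesym N R j) [::] = 0.
Proof.
case: j => // j jN; pose i := Ordinal jN.
rewrite /ecoef -[j]/(nat_of_ord i) symf_mesym mults_nil mcoeffX.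
by rewrite -mdeg_eq0 mdeg1.
Qed.

Lemma ecoef_mesym_seq1 j k : (0 < j <= N)%N -> (0 < k <= N)%N ->
  ecoef (mesym N R j) [:: k] = (j == k)%:R.
Proof.
case: j => // j jN; case: k => // k kN; pose i := Ordinal jN; pose l := Ordinal kN.
by rewrite /ecoef -[j]/(nat_of_ord i) -[k]/(nat_of_ord l) symf_mesym mults_seq1 mcoeffXU.
Qed.

Lemma hsym_rec d : (0 < d)%N ->
  hsym N R d = - \sum_(i < d) (-1) ^+ i.+1 *: (mesym N R i.+1 * hsym N R (d - i.+1)).
Proof.
move=> d0; have := sum_eh N R d0; rewrite big_ord_recl expr0 mesym0E !mul1r subn0.
move/eqP; rewrite addr_eq0 => /eqP ->; congr (- _); apply: eq_bigr => i _.
by rewrite -mul_mpolyC rmorphXn rmorphN1 mulrA.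
Qed.

Lemma mesym_hsym_sym (c : R) i j : c *: (mesym N R i * hsym N R j) \is symmetric.
Proof. by rewrite rpredZ // rpredM ?mesym_sym ?hsym_sym. Qed.

Lemma ecoef_hsym_nil d : (d <= N)%N -> ecoef (hsym N R d) [::] = (d == 0)%:R.
Proof.
case: d => [|d] dN; first by rewrite hsym0 ecoef1_nil.
rewrite hsym_rec // ecoefN ?ecoef_sumr => [|i _|]; try exact: mesym_hsym_sym; last first.
  by apply: rpred_sum => i _; apply: mesym_hsym_sym.
rewrite big1 ?oppr0 // => i _; have := ltn_ord i => il.
rewrite ecoefZ ?rpredM ?mesym_sym ?hsym_sym // ecoefM_nil ?mesym_sym ?hsym_sym //.
by rewrite ecoef_mesym_nil ?mul0r ?mulr0 //; lia.
Qed.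

(** In the recursion for h_d, all products but e_d h_0 have two factors of positive degree and
    contribute nothing. *)
Lemma ecoef_hsym_seq1 d k : (0 < d <= N)%N -> (0 < k <= N)%N ->
  ecoef (hsym N R d) [:: k] = (-1) ^+ d.-1 * (d == k)%:R.
Proof.
case: d => // d /= dN kN.
rewrite hsym_rec // ecoefN ?ecoef_sumr => [|i _|]; try exact: mesym_hsym_sym; last first.
  by apply: rpred_sum => i _; apply: mesym_hsym_sym.
have mhE i c : ecoef (c *: (mesym N R i.+1 * hsym N R (d.+1 - i.+1))) [:: k]
    = c * (ecoef (mesym N R i.+1) [:: k] * ecoef (hsym N R (d - i)) [::]
           + ecoef (mesym N R i.+1) [::] * ecoef (hsym N R (d - i)) [:: k]).
  by rewrite ecoefZ ?rpredM ?mesym_sym ?hsym_sym // ecoefM_seq1 ?mesym_sym ?hsym_sym.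
rewrite big_ord_recr big1 ?add0r => [|i _]; rewrite mhE /=.
  rewrite subnn ecoef_hsym_nil // mulr1 ecoef_mesym_seq1 // ecoef_mesym_nil //.
  by rewrite mul0r addr0 add0r exprS mulN1r mulNr opprK.
have := ltn_ord i => il; rewrite ecoef_hsym_nil ?ecoef_mesym_nil; try lia.
by rewrite mul0r addr0 subn_eq0 leqNgt il !mulr0.
Qed.

Lemma omega_sym f : omega f \is symmetric.
Proof. by apply: mcomp_sym => i; rewrite -tnth_nth tnth_mktuple hsym_sym. Qed.

Lemma omegaB f g : f \is symmetric -> g \is symmetric ->
  omega (f - g) = omega f - omega g.
Proof.
by move=> fs gs; rewrite /omega symfD ?rpredN // symfN // raddfB.
Qed.

Lemma omegaZ c f : f \is symmetric -> omega (c *: f) = c *: omega f.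
Proof. by move=> fs; rewrite /omega symfZ // comp_mpolyZ. Qed.

Lemma omega_sum (I : Type) (r : seq I) (P : pred I) (F : I -> {mpoly R[N]}) :
  (forall i, P i -> F i \is symmetric) ->
  omega (\sum_(i <- r | P i) F i) = \sum_(i <- r | P i) omega (F i).
Proof. by move=> Fs; rewrite /omega symf_sum // raddf_sum. Qed.

Lemma omega_prod (I : Type) (r : seq I) (P : pred I) (F : I -> {mpoly R[N]}) :
  (forall i, P i -> F i \is symmetric) ->
  omega (\prod_(i <- r | P i) F i) = \prod_(i <- r | P i) omega (F i).
Proof.
move=> Fs; elim: r => [|i r IH]; first by rewrite !big_nil omega1.
rewrite !big_cons; case: ifP => // Pi.
by rewrite omegaM ?IH ?Fs // rpred_prod.
Qed.

End Ecoef.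

(** * Change of coefficient ring *)

Section MapMpoly.
Variables (N : nat) (R S : comNzRingType) (phi : {rmorphism R -> S}).

Lemma map_mpoly_sym (f : {mpoly R[N]}) :
  f \is symmetric -> map_mpoly phi f \is symmetric.
Proof.
move=> /issymP fs; apply/issymP => s; apply/mpolyP => u.
by rewrite mcoeff_sym !mcoeff_map_mpoly -mcoeff_sym fs.
Qed.

Lemma map_mpoly_mesym j : map_mpoly phi (mesym N R j) = mesym N S j.
Proof. by apply/mpolyP => u; rewrite mcoeff_map_mpoly !mcoeff_mesym; apply: rmorph_nat. Qed.

Lemma map_mpoly_hsym j : map_mpoly phi (hsym N R j) = hsym N S j.
Proof. by apply/mpolyP => u; rewrite mcoeff_map_mpoly !hsym_coeff; apply: rmorph_nat. Qed.

End MapMpoly.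

(** * The images of the rho_n under omega at q = 1 *)

Section RhoAt1.
Variable N : nat.

Lemma rho_rec n : (0 < n)%N ->
  rho N n = qint n *: hsym N {poly rat} n
            - \sum_(1 <= i < n) hsym N {poly rat} i * rho N (n - i).
Proof. by move=> n0; rewrite rhoE // big_ltn // hsym0 mul1r subn0 addrK. Qed.

Lemma rho_sym n : rho N n \is symmetric.
Proof.
elim/ltn_ind: n => -[|n] IH; first by rewrite /rho /= rpred0.
rewrite rho_rec // rpredB ?rpredZ ?hsym_sym // big_nat rpred_sum // => i ib.
by rewrite rpredM ?hsym_sym ?IH //; lia.
Qed.

(* This is [(-1)^(n-1) p_n]. *)
Definition omega_rho1 (n : nat) : {mpoly rat[N]} :=
  map_mpoly (horner_eval 1) (omega (rho N n)).

Lemma omega_rho1_sym n : omega_rho1 n \is symmetric.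
Proof. exact/map_mpoly_sym/omega_sym. Qed.

Lemma qint1 n : (qint n).[1] = n%:R.
Proof.
rewrite /qint horner_sum (eq_bigr (fun=> 1)) => [|i _]; last by rewrite hornerXn expr1n.
by rewrite sumr_const card_ord.
Qed.

(** This is Newton's identity: [n]_q becomes n at q = 1, and [omega] turns h_i into e_i. The latter
    requires i <= N, whence the bound on n. *)
Lemma omega_rho1_rec n : (0 < n <= N)%N ->
  omega_rho1 n = n%:R *: mesym N _ n
                 - \sum_(1 <= i < n) mesym N _ i * omega_rho1 (n - i).
Proof.
case/andP=> n0 nN; have hr i j : hsym N {poly rat} i * rho N j \is symmetric.
  by rewrite rpredM ?hsym_sym ?rho_sym.
rewrite /omega_rho1 rho_rec // omegaB ?rpredZ ?hsym_sym //; last exact: rpred_sum.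
rewrite omegaZ ?hsym_sym // omega_h // omega_sum //.
rewrite rmorphB /= map_mpolyZ [X in X *: _]qint1 map_mpoly_mesym rmorph_sum /=.
congr (_ - _); apply: eq_big_nat => i ib.
rewrite omegaM ?hsym_sym ?rho_sym // omega_h; last lia.
by rewrite rmorphM /= map_mpoly_mesym.
Qed.

Lemma ecoef_omega_rho1_nil n : (0 < n <= N)%N -> ecoef (omega_rho1 n) [::] = 0.
Proof.
move=> nN; have mr i j : mesym N rat i * omega_rho1 j \is symmetric.
  by rewrite rpredM ?mesym_sym ?omega_rho1_sym.
rewrite omega_rho1_rec // ecoefD ?ecoefN ?rpredN ?rpred_sum ?rpredZ ?mesym_sym //.
rewrite ecoefZ ?mesym_sym // ecoef_mesym_nil // mulr0 add0r ecoef_sumr //.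
rewrite big_nat big1 ?oppr0 // => i ib.
by rewrite ecoefM_nil ?mesym_sym ?omega_rho1_sym // ecoef_mesym_nil ?mul0r //; lia.
Qed.

(** Only n e_n survives, the other terms of the recursion being products of factors of positive
    degree. *)
Lemma ecoef_omega_rho1_seq1 n k : (0 < n <= N)%N -> (0 < k <= N)%N ->
  ecoef (omega_rho1 n) [:: k] = n%:R * (n == k)%:R.
Proof.
move=> nN kN; have mr i j : mesym N rat i * omega_rho1 j \is symmetric.
  by rewrite rpredM ?mesym_sym ?omega_rho1_sym.
rewrite omega_rho1_rec // ecoefD ?ecoefN ?rpredN ?rpred_sum ?rpredZ ?mesym_sym //.
rewrite ecoefZ ?mesym_sym // ecoef_mesym_seq1 // ecoef_sumr //.
rewrite big_nat big1 ?subr0 // => i ib.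
rewrite ecoefM_seq1 ?mesym_sym ?omega_rho1_sym // ecoef_mesym_nil; last lia.
by rewrite ecoef_omega_rho1_nil ?mul0r ?mulr0 ?addr0 //; lia.
Qed.

(** The power of q given by [wt] becomes 1, so only the cycle lengths of [s] matter from here on. *)
Lemma gk_at1E n (m : 'I_n -> 'I_n) k : gk_at1 N m k =
  \sum_(s in hess_perms m | (n - k <= size (head [::] (cycles s)))%N)
    (-1) ^+ (size (head [::] (cycles s)) + k - n) *:
      (hsym N rat (size (head [::] (cycles s)) + k - n) *
       \prod_(t <- behead (cycles s)) omega_rho1 (size t)).
Proof.
rewrite /gk_at1 /gk rmorph_sum; apply: eq_bigr => s _ /=.
rewrite map_mpolyZ [map_mpoly _ (_ * _)]rmorphM /= map_mpoly_hsym.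
rewrite omega_prod => [|t _]; last exact: rho_sym.
by rewrite rmorph_prod /horner_eval !hornerE expr1n mulr1.
Qed.

End RhoAt1.

(** * The contribution of a single permutation *)

Section Contribution.
Variables (n : nat) (s : 'S_n.+1).

(** [ord0] is enumerated first and is minimal in its orbit. *)
Lemma cyclesE : cycles s = orbit s ord0 :: behead (cycles s).
Proof.
by rewrite /cycles enum_ordSl /= ifT //; apply/forall_inP.
Qed.

Lemma cycle_size_gt0 t : t \in cycles s -> (0 < size t)%N.
Proof. by case/mapP=> i _ ->; rewrite size_orbit order_gt0. Qed.

Lemma size_head_cycles : size (head [::] (cycles s)) = order s ord0.
Proof. by rewrite cyclesE /= size_orbit. Qed.

Lemma sum_cycle_sizes :
  (size (head [::] (cycles s)) + sumn (map size (behead (cycles s))))%N = n.+1.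
Proof.
have := perm_size (perm_flatten_cycles s).
by rewrite size_enum_ord size_flatten cyclesE.
Qed.

Lemma behead_cyclesP t : t \in behead (cycles s) ->
  exists2 i, i \notin orbit s ord0 & t = orbit s i.
Proof.
move=> ts; have /mapP[i _ tE] : t \in cycles s by rewrite cyclesE inE ts orbT.
exists i => //; have := perm_uniq (perm_flatten_cycles s).
rewrite enum_uniq cyclesE /= cat_uniq => /and3P[_ /hasPn /(_ i) + _]; apply.
by apply/flattenP; exists t => //; rewrite tE in_orbit.
Qed.

Lemma bicycle_behead (m : 'I_n.+1 -> 'I_n.+1) k : (0 < k <= n)%N ->
  s \in bicycles m k -> size (behead (cycles s)) = 1%N.
Proof.
move=> kn; rewrite inE => /and3P[_ /eqP o0 /forallP ok].
have sz : map size (behead (cycles s)) = nseq (size (behead (cycles s))) k.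
  rewrite -[X in nseq X](size_map size); apply/all_pred1P; rewrite all_map; apply/allP => t /behead_cyclesP[i i0 ->] /=.
  by rewrite size_orbit; apply: implyP (ok i) i0.
have := sum_cycle_sizes; rewrite sz sumn_nseq size_head_cycles o0; nia.
Qed.

Lemma full_behead : (order s ord0 == n.+1) = (behead (cycles s) == [::]).
Proof.
rewrite -size_head_cycles; have := sum_cycle_sizes.
case E : behead => [|t r] /= sz; first by move: sz; rewrite addn0 => ->; rewrite !eqxx.
have t0 : (0 < size t)%N by apply: cycle_size_gt0; rewrite cyclesE E !inE eqxx orbT.
by apply/negbTE; move: sz t0; lia.
Qed.

Section Product.
Variables (N : nat) (nN : (n < N)%N).

Let weight (t : seq 'I_n.+1) := (0 < size t <= N)%N.

Lemma behead_weight : all weight (behead (cycles s)).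
Proof.
apply/allP => t ts; have := @cycle_size_gt0 t.
rewrite cyclesE inE ts orbT /weight => /(_ isT) -> /=.
by case/behead_cyclesP: ts => i _ ->; rewrite size_orbit (leq_trans (max_card _)) ?card_ord.
Qed.

Lemma omega_rho1_prod_sym (r : seq (seq 'I_n.+1)) :
  \prod_(t <- r) omega_rho1 N (size t) \is symmetric.
Proof. by apply: rpred_prod => t _; apply: omega_rho1_sym. Qed.

Lemma ecoef_prod_nil t r : all weight (t :: r) ->
  ecoef (\prod_(u <- t :: r) omega_rho1 N (size u)) [::] = 0.
Proof.
case/andP=> tN _; rewrite big_cons ecoefM_nil ?omega_rho1_sym ?omega_rho1_prod_sym //.
by rewrite ecoef_omega_rho1_nil // mul0r.
Qed.

Lemma ecoef_prod_seq1 t u r k : all weight [:: t, u & r] -> (0 < k <= N)%N ->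
  ecoef (\prod_(v <- [:: t, u & r]) omega_rho1 N (size v)) [:: k] = 0.
Proof.
move=> /andP[tN urN] kN; rewrite big_cons ecoefM_seq1 ?omega_rho1_sym ?omega_rho1_prod_sym //.
by rewrite ecoef_prod_nil // ecoef_omega_rho1_nil // mul0r mulr0 addr0.
Qed.

(** The cases are the number of cycles avoiding [ord0]: none gives -1, two or more give 0, and a
    single one gives its length if d = 0 and 0 otherwise. An inequality suffices below, and it
    avoids showing that the permutations contributing k are bicycles. *)
Lemma ecoef_term (m : 'I_n.+1 -> 'I_n.+1) k : s \in hess_perms m ->
    (0 < k <= n)%N -> (n.+1 - k <= size (head [::] (cycles s)))%N ->
  let d := (size (head [::] (cycles s)) + k - n.+1)%N in
  (k * (s \in bicycles m k))%:R - (s \in full_cycles m)%:R <=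
  ecoef ((-1) ^+ d *: (hsym N rat d *
    \prod_(t <- behead (cycles s)) omega_rho1 N (size t))) [:: k].
Proof.
move=> sm kn ka; cbv zeta; set d := (_ - n.+1)%N.
have kN : (0 < k <= N)%N by lia.
have dN : (d <= N)%N.
  by have := sum_cycle_sizes; rewrite /d; lia.
have hPs := omega_rho1_prod_sym (behead (cycles s)).
rewrite ecoefZ ?rpredM ?hsym_sym // ecoefM_seq1 ?hsym_sym // ecoef_hsym_nil //.
have Efull : (s \in full_cycles m) = (behead (cycles s) == [::]).
  by rewrite inE sm full_behead.
have Ebi := bicycle_behead kn; rewrite Efull.
have sumE := sum_cycle_sizes; have wt := behead_weight.
case E : (behead (cycles s)) Ebi sumE wt => [|t r] Ebi sumE wt.
  rewrite (_ : s \in bicycles m k = false); last by apply/negP => /Ebi.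
  (* For an n-cycle the product is empty and d = k, so the sign (-1)^k of the term meets the
     (-1)^(k-1) of h_k. *)
  have dk : d = k by move: sumE; rewrite /d /=; lia.
  rewrite big_nil ecoef1_nil dk ecoef_hsym_seq1 // eqxx !mulr1 gtn_eqF ?mul0r ?addr0; last lia.
  by case: k {dk ka d dN Ebi} kn kN => // k _ _; rewrite exprS -mulrA -expr2 sqrr_sign mulr1 muln0.
rewrite ecoef_prod_nil // mulr0 add0r subr0.
case: r => [|u r] in E Ebi sumE wt *; last first.
  rewrite ecoef_prod_seq1 // !mulr0 (_ : s \in bicycles m k = false) ?muln0 //.
  by apply/negP => /Ebi.
(* The product has no constant term, so h_d must contribute its own, which vanishes unless d = 0. *)
have [d0|d0] := eqVneq d 0%N; last first.
  rewrite mul0r mulr0 (_ : s \in bicycles m k = false) ?muln0 //.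
  by apply/negP; rewrite inE => /and3P[_ /eqP o0 _]; move: d0; rewrite /d size_head_cycles o0; lia.
have tk : size t = k by move: d0 sumE; rewrite /d /=; lia.
rewrite d0 expr0 !mul1r big_seq1 ecoef_omega_rho1_seq1 ?tk // eqxx mulr1 ler_nat.
by case: (s \in _); rewrite ?muln1 ?muln0.
Qed.

End Product.

End Contribution.

(** * Summation over all permutations *)

Lemma gk_term_sym (N n d : nat) (c : rat) (r : seq (seq 'I_n.+1)) :
  c *: (hsym N rat d * \prod_(t <- r) omega_rho1 N (size t)) \is symmetric.
Proof. by rewrite rpredZ // rpredM ?hsym_sym ?omega_rho1_prod_sym. Qed.

Theorem theorem1p9 (n : nat) (n_ge1 : (1 <= n)%N)
  (m : 'I_n -> 'I_n) (m_hess : hessenberg m) (k : nat) (k_lt_n : (k < n)%N)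
  (N : nat) (n_le_N : (n <= N)%N) :
  0 <= ecoef (gk_at1 N m k) [:: k].
Proof.
case: n n_ge1 m m_hess k_lt_n n_le_N => // n _ m m_hess k_lt_n n_le_N.
rewrite gk_at1E ecoef_sumr => [|s _]; last exact: gk_term_sym.
case: (posnP k) => [k0|k_gt0].
  (* For k = 0 the coefficient of e_0 is the constant term. Only n-cycles satisfy the length
     condition, and each of them contributes 1. *)
  apply: sumr_ge0 => s /andP[_]; rewrite k0 subn0 /ecoef => le.
  have head_n : size (head [::] (cycles s)) = n.+1 by have := sum_cycle_sizes s; lia.
  have -> : mults N [:: 0%N] = mults N [::] by apply/mnmP => i; rewrite !mnmE.
  rewrite -/(ecoef _ [::]) head_n addn0 subnn.
  have /eqP -> : behead (cycles s) == [::] by rewrite -full_behead -size_head_cycles head_n.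
  by rewrite big_nil hsym0 mulr1 scale1r ecoef1_nil.
have le_term : \sum_(s in hess_perms m | (n.+1 - k <= size (head [::] (cycles s)))%N)
    ((k * (s \in bicycles m k))%:R - (s \in full_cycles m)%:R) <=
  \sum_(s in hess_perms m | (n.+1 - k <= size (head [::] (cycles s)))%N)
    ecoef ((-1) ^+ (size (head [::] (cycles s)) + k - n.+1) *:
      (hsym N rat (size (head [::] (cycles s)) + k - n.+1) *
       \prod_(t <- behead (cycles s)) omega_rho1 N (size t))) [:: k].
  by apply: ler_sum => s /andP[sm ka]; apply: ecoef_term => //; rewrite k_gt0.
apply: le_trans le_term; rewrite sumrB subr_ge0 -!natr_sum ler_nat.
(* Removing the length condition can only increase the count of n-cycles, while every bicycle
   satisfies it since its first cycle has exactly n + 1 - k elements. *)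
apply: (@leq_trans #|full_cycles m|).
  rewrite -sum1_card big_mkcond [leqRHS]big_mkcond; apply: leq_sum => s _.
  by case: ifP; case: (s \in full_cycles m).
apply: leq_trans (card_full_cycles m_hess k_gt0 k_lt_n) _.
rewrite -big_distrr leq_mul2l -sum1_card big_mkcond [leqRHS]big_mkcond.
apply/orP; right; apply: leq_sum => s _; case: ifP => // sb.
by move: (sb); rewrite inE size_head_cycles => /and3P[-> /eqP-> _]; rewrite leqnn.
Qed.
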